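(* Let $\tau>0$. The integral operator with the $\sin/\sinh$ kernel $$K(x,y)=\frac{B\sin A(x-y)}{A\sinh B(x-y)}$$ or the $\sinh/\sinh$ kernel $$K(x,y)=\frac{B\sinh A(x-y)}{A\sinh B(x-y)}$$ (where $B>0$, $A\in\mathbb{R}$, $A\ne0$), restricted to the interval $[-\tau,\tau]$, commutes with the Sturm--Liouville operator $Df=(pf')'+qf$, where $$p(x)=\frac{\sinh^2(Bx)-\sinh^2(B\tau)}{B^2},\qquad q(x)=\frac{(B^2\pm A^2)\sinh^2(Bx)}{B^2},$$ and the plus sign is taken for the $\sin/\sinh$ kernel while the minus sign is taken for the $\sinh/\sinh$ kernel. The same is true in the limit cases $A=0$ or $B=0$.
   Context: The kernels are translation invariant kernels on $\mathbb{R}\times\mathbb{R}$, equal to $1$ on the diagonal $x=y$ (extension by continuity). The integral operator restricted to $[-\tau,\tau]$ is the one with kernel $K(x,y)$ restricted to $[-\tau,\tau]\times[-\tau,\tau]$, with respect to Lebesgue measure. In the limit cases the kernel and the functions $p,q$ are replaced by their limits as $A\to0$ or as $B\to0$: for $A=0$ (with $B>0$), $K(x,y)=B(x-y)/\sinh B(x-y)$, $p(x)=(\sinh^2(Bx)-\sinh^2(B\tau))/B^2$, $q(x)=\sinh^2(Bx)$; for $B=0$ (with $A\in\mathbb{R}$, $A\neq0$), the limit of the $\sin/\sinh$ kernel is $K(x,y)=\sin A(x-y)/(A(x-y))$ with $p(x)=x^2-\tau^2$, $q(x)=A^2x^2$, and the limit of the $\sinh/\sinh$ kernel is $K(x,y)=\sinh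 A(x-y)/(A(x-y))$ with $p(x)=x^2-\tau^2$, $q(x)=-A^2x^2$. *)

(* Defs.v *)
From HB Require Import structures.
From mathcomp Require Import all_boot all_order all_algebra.
From mathcomp Require Import all_classical all_reals all_analysis.

Set Implicit Arguments.
Unset Strict Implicit.
Unset Printing Implicit Defensive.

Import Order.TTheory GRing.Theory Num.Theory.
Import numFieldNormedType.Exports.

Local Open Scope classical_set_scope.
Local Open Scope ring_scope.

Definition sinh {R : realType} (x : R) : R := (expR x - expR (- x)) / 2.

(* The kernel (x, y) |-> k (x - y), where k has a removable singularity at 0
   with limit 1; the value 1 on the diagonal is the extension by continuity. *)
Definition conv_kernel {R : realType} (k : R -> R) (x y : R) : R :=
  if x == y then 1 else k (x - y).

Definition sin_sinh_kernel {R : realType} (A B : R) : R -> R -> R :=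
  conv_kernel (fun t => B * sin (A * t) / (A * sinh (B * t))).

Definition sinh_sinh_kernel {R : realType} (A B : R) : R -> R -> R :=
  conv_kernel (fun t => B * sinh (A * t) / (A * sinh (B * t))).

(* The limit A -> 0 of both kernels above. *)
Definition id_sinh_kernel {R : realType} (B : R) : R -> R -> R :=
  conv_kernel (fun t => B * t / sinh (B * t)).

(* The limits B -> 0 of sin_sinh_kernel and sinh_sinh_kernel. *)
Definition sin_id_kernel {R : realType} (A : R) : R -> R -> R :=
  conv_kernel (fun t => sin (A * t) / (A * t)).

Definition sinh_id_kernel {R : realType} (A : R) : R -> R -> R :=
  conv_kernel (fun t => sinh (A * t) / (A * t)).

(* (K f)(x) = int_{-tau}^{tau} K(x, y) f(y) dy, a Lebesgue integral. *)
Definition integral_op {R : realType} (tau : R) (K : R -> R -> R) (f : R -> R)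
    (x : R) : R :=
  \int[lebesgue_measure]_(y in `[(- tau), tau]) (K x y * f y).

(* D f = (p f')' + q f.  The derivatives are two-sided, so on a function that
   is only prescribed on [a, b] this is meaningful at the points of ]a, b[. *)
Definition sturm_liouville {R : realType} (p q : R -> R) (f : R -> R)
    (x : R) : R :=
  ((fun t => p t * (f^`())%classic t)^`())%classic x + q x * f x.

(* f is of class C^2 on [a, b]: twice differentiable on ]a, b[, where f, f' and
   f'' extend continuously to [a, b] (f being its own extension).  The values
   of f outside [a, b] are irrelevant. *)
Definition C2_on {R : realType} (a b : R) (f : R -> R) : Prop :=
  exists f1 f2 : R -> R,
    [/\ {within `[a, b], continuous f},
        {within `[a, b], continuous f1},
        {within `[a, b], continuous f2},
        {in `]a, b[, forall x : R, is_derive x 1 f (f1 x)} &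
        {in `]a, b[, forall x : R, is_derive x 1 f1 (f2 x)}].

(* The integral operator with kernel K on [-tau, tau] commutes with the
   differential operator D f = (p f')' + q f on the domain C^2([-tau, tau]):
   the integral operator preserves this domain, and D (K f) = K (D f) on it.
   The endpoints, where sturm_liouville carries no meaning, do not affect
   the integral K (D f). *)
Definition commutes_on {R : realType} (tau : R) (K : R -> R -> R)
    (p q : R -> R) : Prop :=
  forall f : R -> R, C2_on (- tau) tau f ->
    C2_on (- tau) tau (integral_op tau K f) /\
    {in `](- tau), tau[, forall x : R,
       sturm_liouville p q (integral_op tau K f) x =
       integral_op tau K (sturm_liouville p q f) x}.

(* Main.v *)
Require Import Defs.
From HB Require Import structures.
From mathcomp Require Import all_boot all_order all_algebra.
From mathcomp Require Import all_classical all_reals all_analysis.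
From mathcomp Require Import measurable_realfun ring lra.

(* Every kernel has the form k(x - y) with k = u / v, where v'' = beta v and
   u'' = alpha u (v = sinh(Bt)/B or v = t), u and v vanish at 0 with slope 1,
   and in every case p = v^2 - v(tau)^2 and q = (beta - alpha) v^2.  Writing
   u(t) / t and v(t) / t as averages of u' and v' over [0, t] shows that k is
   of class C^2, and differentiating u = v k twice gives
   v k'' + 2 v' k' + (beta - alpha) v k = 0.  The identities
   v(x)^2 - v(y)^2 = v(x + y) v(x - y) and
   v(x) v'(x) + v(y) v'(y) = v(x + y) v'(x - y) turn this into D_x K = D_y K.
   As p vanishes at tau and - tau, moving D_y onto f by integrating by parts
   produces no boundary terms. *)

Import Order.TTheory GRing.Theory Num.Theory.
Import numFieldNormedType.Exports.

Local Open Scope classical_set_scope.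
Local Open Scope ring_scope.

(** * Functions on a segment and integrals depending on a parameter *)

Lemma within_continuousM (R : realType) (A : set R) (f g : R -> R) :
  {within A, continuous f} -> {within A, continuous g} ->
  {within A, continuous (fun x => f x * g x)}.
Proof. by move=> cf cg x; apply: continuousM; [exact: cf|exact: cg]. Qed.

Arguments within_continuousM {R A f g}.

Lemma within_itvcc_bounded (R : realType) (a b : R) (f : R -> R) :
  {within `[a, b], continuous f} ->
  exists2 M, 0 <= M & forall y, `[a, b]%classic y -> `|f y| <= M.
Proof.
move=> cf.
have /compact_bounded[M [_ fM]] := continuous_compact cf (@segment_compact R a b).
(* Boundedness of the compact image gives a bound by every real strictly above [M]; this choice is
   also nonnegative. *)
exists (`|M| + 1); first by rewrite addr_ge0.
move=> y aby; apply: (fM (`|M| + 1)); last by exists y.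
by rewrite (le_lt_trans (ler_norm M))// ltrDl.
Qed.

(* The affine argument covers both convolution (c = 1, d = - y) and the
   representation of h(x) / x as an average of h' (c = y, d = 0). *)
Section affine_integral.
Context {R : realType} (a b : R) (c d : R -> R).
Hypothesis cc : {within `[a, b], continuous c}.
Hypothesis cd : {within `[a, b], continuous d}.
Local Notation mu := (@lebesgue_measure R).

Lemma within_affine_continuous (w h : R -> R) (x : R) :
  {within `[a, b], continuous w} -> continuous h ->
  {within `[a, b], continuous (fun y => w y * h (c y * x + d y))}.
Proof.
move=> cw ch; apply: within_continuousM => //.
apply: (within_continuous_comp _ _ h) => [t _|]; first exact: ch.
apply: within_continuousD => //; apply: within_continuousM => //.
by apply: continuous_subspaceT => ?; exact: cvg_cst.
Qed.

Lemma affine_integrable (w h : R -> R) (x : R) :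
  {within `[a, b], continuous w} -> continuous h ->
  mu.-integrable `[a, b] (EFin \o (fun y => w y * h (c y * x + d y))).
Proof.
move=> cw ch; apply: continuous_compact_integrable; first exact: segment_compact.
exact: within_affine_continuous.
Qed.

(** Supplies the constant that dominates the integrand in continuity and differentiation under the
    integral. For [x'] within distance 1 of [x], the argument of [h] stays in the compact interval
    from [- L] to [L]. *)
Lemma affine_bounded (w h : R -> R) (x : R) :
  {within `[a, b], continuous w} -> continuous h ->
  exists2 C, 0 <= C & forall x' y, `]x - 1, x + 1[%classic x' ->
    `[a, b]%classic y -> `|w y * h (c y * x' + d y)| <= C.
Proof.
move=> cw ch.
have [Mw Mw0 wM] := within_itvcc_bounded _ _ _ _ cw.
have [Mc Mc0 cM] := within_itvcc_bounded _ _ _ _ cc.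
have [Md Md0 dM] := within_itvcc_bounded _ _ _ _ cd.
pose L := Mc * (`|x| + 1) + Md.
have chL : {within `[- L, L], continuous h} by exact: continuous_subspaceT.
have [Mh Mh0 hM] := within_itvcc_bounded _ _ _ _ chL.
exists (Mw * Mh); first exact: mulr_ge0.
move=> x' y; rewrite /= in_itv/= => /andP[x1 x2] aby.
rewrite normrM; apply: ler_pM => //; first exact: wM.
apply: hM; rewrite /= in_itv/= -ler_norml.
apply: (le_trans (ler_normD _ _)); apply: lerD; last exact: dM.
rewrite normrM; apply: ler_pM => //; first exact: cM.
rewrite ler_norml; have := ler_norm x; have := ler_norm (- x).
rewrite normrN => ? ?.
by apply/andP; split; lra.
Qed.

Lemma continuous_affine_integral (w h : R -> R) :
  {within `[a, b], continuous w} -> continuous h ->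
  continuous (fun x => \int[mu]_(y in `[a, b]) (w y * h (c y * x + d y))).
Proof.
move=> cw ch x.
have [C C0 wC] := affine_bounded w h x cw ch.
apply: (@continuity_under_integral R _ _ mu (fun x y => w y * h (c y * x + d y))
   `[a, b] _ (x - 1) (x + 1) _ _ (cst C)).
- exact: measurable_itv.
- by move=> x' _; exact: affine_integrable.
- apply: aeW => y _ x' _; apply: cvgM; first exact: cvg_cst.
  apply: continuous_comp; last exact: ch.
  by apply: cvgD; [apply: cvgM; [exact: cvg_cst|exact: cvg_id]|exact: cvg_cst].
- apply: continuous_compact_integrable; first exact: segment_compact.
  by apply: continuous_subspaceT => ?; exact: cvg_cst.
- by move=> x' x'I; apply: aeW => y aby; exact: wC.
- by rewrite inE/= in_itv/=; apply/andP; split; lra.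
Qed.

Lemma is_derive_affine_integral (w h h1 : R -> R) (x : R) :
  {within `[a, b], continuous w} ->
  (forall t : R, is_derive t 1 h (h1 t)) -> continuous h1 ->
  is_derive x 1 (fun x => \int[mu]_(y in `[a, b]) (w y * h (c y * x + d y)))
    (\int[mu]_(y in `[a, b]) (w y * c y * h1 (c y * x + d y))).
Proof.
move=> cw dh ch1.
have ch : continuous h.
  by move=> t; apply/differentiable_continuous/derivable1_diffP/ex_derive.
have cwc : {within `[a, b], continuous (fun y => w y * c y)}.
  exact: within_continuousM.
(* The derivative of the integrand in [x] has the same affine form, with weight [w y * c y] and
   profile [h1], so the same bound dominates it. *)
have [C C0 wC] := affine_bounded _ h1 x cwc ch1.
pose F (x y : R) := w y * h (c y * x + d y).
have dF (x' y : R) : is_derive x' 1 (F ^~ y) (w y * c y * h1 (c y * x' + d y)).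
  have -> : F ^~ y = w y \*: (h \o (c y \*: id + cst (d y))) by apply/funext.
  have dA : is_derive x' 1 (c y \*: id + cst (d y)) (c y).
    apply: is_derive_eq; rewrite addr0; exact: mulr1.
  have dhA := is_derive1_comp (f := h) (g := c y \*: id + cst (d y))
    (dh (c y * x' + d y)) dA.
  apply: is_derive_eq; rewrite [LHS]mulrA; ring.
have d1F (x' y : R) : partial1of2 F x' y = w y * c y * h1 (c y * x' + d y).
  by rewrite /partial1of2 derive1E; apply: derive_val.
have Ix : `]x - 1, x + 1[%classic x by rewrite /= in_itv/=; apply/andP; split; lra.
have iF (x' : R) : mu.-integrable `[a, b] (EFin \o F x').
  exact: affine_integrable.
have iC : mu.-integrable `[a, b] (EFin \o (cst C : R -> R)).
  apply: continuous_compact_integrable; first exact: segment_compact.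
  by apply: continuous_subspaceT => ?; exact: cvg_cst.
have derF (x' y : R) : `]x - 1, x + 1[%classic x' -> `[a, b]%classic y ->
  derivable (F ^~ y) x' 1 by move=> _ _; exact: ex_derive.
have FC (x' y : R) : `]x - 1, x + 1[%classic x' -> `[a, b]%classic y ->
  `|partial1of2 F x' y| <= cst C y by move=> x'I aby; rewrite d1F; exact: wC.
have mab : measurable (`[a, b]%classic : set (measurableTypeR R)).
  exact: measurable_itv.
apply: DeriveDef.
  exact: (@derivable_under_integral R _ _ mu F `[a, b] mab x (x - 1) (x + 1) Ix
    (fun x' _ => iF x') derF (cst C) (fun=> C0) iC FC).
rewrite -derive1E.
rewrite (@differentiation_under_integral R _ _ mu F `[a, b] mab x (x - 1) (x + 1) Ix
    (fun x' _ => iF x') derF (cst C) (fun=> C0) iC FC).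
by apply: eq_Rintegral => y _; rewrite d1F.
Qed.

End affine_integral.

(** * Smoothness of quotients with a removable singularity at 0 *)

Lemma is_derive_continuous (R : realType) (f f1 : R -> R) :
  (forall x : R, is_derive x 1 f (f1 x)) -> continuous f.
Proof.
by move=> df x; apply/differentiable_continuous/derivable1_diffP/ex_derive.
Qed.

Lemma within_continuous_FTC2 (R : realType) (a b : R) (f F : R -> R) : a < b ->
  {within `[a, b], continuous f} -> {within `[a, b], continuous F} ->
  {in `]a, b[, forall x : R, is_derive x 1 F (f x)} ->
  \int[lebesgue_measure]_(x in `[a, b]) f x = F b - F a.
Proof.
move=> ab cf cF dF.
rewrite /Rintegral (continuous_FTC2 ab cf (F := F))//.
- move: cF => /(continuous_within_itvP _ ab)[_ Fa Fb]; split => // x xab.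
  exact: (@ex_derive _ _ _ _ _ _ _ (dF x xab)).
- move=> x xab; rewrite derive1E.
  exact: (@derive_val _ _ _ _ _ _ _ (dF x xab)).
Qed.

(* g(x) is the integral of h1(s x) over s in [0, 1], which is smooth at 0 too. *)
Lemma divided_difference_C2 (R : realType) (h h1 h2 h3 : R -> R) :
  (forall x : R, is_derive x 1 h (h1 x)) ->
  (forall x : R, is_derive x 1 h1 (h2 x)) ->
  (forall x : R, is_derive x 1 h2 (h3 x)) -> continuous h3 -> h 0 = 0 ->
  exists g g1 g2 : R -> R,
    [/\ forall x : R, is_derive x 1 g (g1 x),
        forall x : R, is_derive x 1 g1 (g2 x), continuous g2,
        forall x, h x = x * g x & g 0 = h1 0].
Proof.
move=> dh dh1 dh2 ch3 h00.
have ccst (k : R) : {within `[0, 1], continuous (cst k : R -> R)}.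
  by apply: continuous_subspaceT => ?; exact: cvg_cst.
have cid : {within `[0, 1], continuous (fun s : R => s)}.
  by apply: continuous_subspaceT => ?; exact: cvg_id.
have cw1 : {within `[0, 1], continuous (fun s : R => 1 * s)}.
  exact: within_continuousM (ccst 1) cid.
have cw2 : {within `[0, 1], continuous (fun s : R => 1 * s * s)}.
  exact: within_continuousM cw1 cid.
have ch1 := is_derive_continuous _ _ _ dh1.
have ch2 := is_derive_continuous _ _ _ dh2.
(* The affine integral with [c s = s] and [d = 0]. Each differentiation in [x] brings out a factor
   [s], hence the weights 1, [s], [s * s] below. *)
pose I (w k : R -> R) (x : R) : R :=
  \int[lebesgue_measure]_(s in `[0, 1]) (w s * k (s * x + 0)).
exists (I (cst 1) h1), (I (fun s => 1 * s) h2), (I (fun s => 1 * s * s) h3).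
split.
- move=> x; exact: (is_derive_affine_integral 0 1 _ _ cid (ccst 0) (cst 1)).
- move=> x.
  exact: (is_derive_affine_integral 0 1 _ _ cid (ccst 0) (fun s => 1 * s)).
- exact: (continuous_affine_integral 0 1 _ _ cid (ccst 0) (fun s => 1 * s * s)).
- move=> x; rewrite -RintegralZl; last 2 first.
  + exact: measurable_itv.
  + exact: (affine_integrable 0 1 _ _ cid (ccst 0) (cst 1)).
  (* As a function of [s], [h (x * s)] is a primitive of [x * h1 (s * x)], and its increment over
     [0, 1] is [h x - h 0 = h x]. *)
  have dhx (s : R) : is_derive s 1 (h \o (x \*: id)) (h1 (x * s) * x).
    have dA : is_derive s 1 (x \*: id) x by apply: is_derive_eq; exact: mulr1.
    exact: (is_derive1_comp (f := h) (dh (x * s)) dA).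
  rewrite (within_continuous_FTC2 _ _ _ _ (h \o (x \*: id))) ?ltr01//.
  + by rewrite /= !scaler0 h00 subr0; congr h; rewrite [RHS]mulr1.
  + apply: (within_continuousM (ccst x)).
    exact: (within_affine_continuous 0 1 _ _ cid (ccst 0) (cst 1)).
  + by apply: continuous_subspaceT; apply: is_derive_continuous dhx.
  + move=> s _; apply: is_derive_eq; rewrite mul1r addr0 mulrC; congr (_ * h1 _).
    exact: mulrC.
(* At 0 the integrand is the constant [h1 0], over an interval of length 1. *)
- rewrite /I; under eq_Rintegral do rewrite mulr0 addr0 mul1r.
  rewrite Rintegral_cst; last exact: measurable_itv.
  have -> : fine (lebesgue_measure (`[0, 1]%classic : set R)) = 1.
    by rewrite lebesgue_measure_itv/= lte_fin ltr01 sube0.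
  by rewrite mulr1.
Qed.

(** Both functions have a factor [x]: [u x = x * g x] and [v x = x * l x]. Here [l] has no zero,
    since [l 0 = v1 0], so [g / l] is the smooth extension of [u / v] across 0. Dividing by [x]
    costs one derivative, hence the three derivatives assumed of [u] and [v]. *)
Lemma quotient_C2 (R : realType) (u u1 u2 u3 v v1 v2 v3 : R -> R) :
  (forall x : R, is_derive x 1 u (u1 x)) ->
  (forall x : R, is_derive x 1 u1 (u2 x)) ->
  (forall x : R, is_derive x 1 u2 (u3 x)) -> continuous u3 -> u 0 = 0 ->
  (forall x : R, is_derive x 1 v (v1 x)) ->
  (forall x : R, is_derive x 1 v1 (v2 x)) ->
  (forall x : R, is_derive x 1 v2 (v3 x)) -> continuous v3 -> v 0 = 0 ->
  v1 0 != 0 -> (forall x, x != 0 -> v x != 0) ->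
  exists k k1 k2 : R -> R,
    [/\ forall x : R, is_derive x 1 k (k1 x),
        forall x : R, is_derive x 1 k1 (k2 x), continuous k2,
        forall x, v x * k x = u x & k 0 = u1 0 / v1 0].
Proof.
move=> du du1 du2 cu3 u0 dv dv1 dv2 cv3 v0 v10 vneq0.
have [g [g1 [g2 [dg dg1 cg2 ug g0]]]] :=
  divided_difference_C2 _ _ _ _ _ du du1 du2 cu3 u0.
have [l [l1 [l2 [dl dl1 cl2 vl l0]]]] :=
  divided_difference_C2 _ _ _ _ _ dv dv1 dv2 cv3 v0.
have lneq0 x : l x != 0.
  have [->|x0] := eqVneq x 0; first by rewrite l0.
  by have := vneq0 _ x0; rewrite vl mulf_eq0 (negbTE x0).
(* [i], [i1], [i2] are [1 / l] and its first two derivatives, written so that continuity follows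
   from that of [l], [l1], [l2] and [i]. *)
pose i x := (l x)^-1.
pose i1 x := - (l1 x * i x * i x).
have di x : is_derive x (1 : R) i (i1 x).
  apply: is_derive_eq (is_deriveV (lneq0 x) (dl x)) _.
  by rewrite /i1 /i /GRing.scale/=; field.
have ci := is_derive_continuous _ _ _ di.
have cl1 := is_derive_continuous _ _ _ dl1.
have cg := is_derive_continuous _ _ _ dg.
have cg1 := is_derive_continuous _ _ _ dg1.
pose i2 x := - (l2 x * i x * i x + 2 * l1 x * i x * i1 x).
have di1 x : is_derive x (1 : R) i1 (i2 x).
  have -> : i1 = - (l1 * i * i) by apply/funext.
  by apply: is_derive_eq; rewrite /i2 /GRing.scale/= !fctE; ring.
have ci1 := is_derive_continuous _ _ _ di1.
exists (g * i), (g1 * i + g * i1), (g2 * i + cst 2 * (g1 * i1) + g * i2).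
split.
- by move=> x; apply: is_derive_eq; rewrite /GRing.scale/= !fctE; ring.
- by move=> x; apply: is_derive_eq; rewrite /GRing.scale/= !fctE; ring.
- have cM (f h : R -> R) :
      continuous f -> continuous h -> continuous (fun x => f x * h x).
    by move=> cf ch x; apply: cvgM; [exact: cf|exact: ch].
  have cD (f h : R -> R) :
      continuous f -> continuous h -> continuous (fun x => f x + h x).
    by move=> cf ch x; apply: cvgD; [exact: cf|exact: ch].
  have c2 : continuous (cst 2 : R -> R) by move=> ?; exact: cvg_cst.
  have ci2 : continuous i2.
    move=> x; apply: cvgN; move: x.
    exact: cD (cM _ _ (cM _ _ cl2 ci) ci) (cM _ _ (cM _ _ (cM _ _ c2 cl1) ci) ci1).
  exact: cD (cD _ _ (cM _ _ cg2 ci) (cM _ _ c2 (cM _ _ cg1 ci1))) (cM _ _ cg ci2).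
- by move=> x; rewrite vl ug fctE /i mulrCA; field.
- by rewrite fctE /i g0 l0.
Qed.

(** * Commutation for smooth convolution kernels *)

(** The endpoints form a null set. This allows [sturm_liouville p q f] under the integral, although
    its endpoint values are arbitrary; its measurability inside is inherited from [g]. *)
Lemma eq_Rintegral_itvoo (R : realType) (a b : R) (f g : R -> R) :
  {in `]a, b[, f =1 g} ->
  lebesgue_measure.-integrable `[a, b] (EFin \o g) ->
  \int[lebesgue_measure]_(x in `[a, b]) f x =
  \int[lebesgue_measure]_(x in `[a, b]) g x.
Proof.
move=> fg ig.
have sub : (`]a, b[ `<=` `[a, b])%classic := @subset_itv_oo_cc _ _ a b.
have mg : measurable_fun `]a, b[ g.
  apply/measurable_EFinP; apply: (measurable_int lebesgue_measure).
  by apply: integrableS ig => //; exact: measurable_itv.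
have mf : measurable_fun `]a, b[ f.
  apply: eq_measurable_fun mg => x; rewrite inE => xab.
  exact/esym/fg.
rewrite /Rintegral (@integral_itv_bndoo _ a b (EFin \o f)); last first.
  exact/measurable_EFinP.
rewrite (@integral_itv_bndoo _ a b (EFin \o g)); last exact/measurable_EFinP.
by congr fine; apply: eq_integral => x; rewrite inE => xab; rewrite /= fg.
Qed.

(** The last hypothesis is D_x K = D_y K for [K x y = k (x - y)]. The [k1] terms add up because
    differentiating [k (x - y)] in [y] changes the sign. *)
Lemma commutes_on_convolution (R : realType) (tau : R) (K : R -> R -> R)
    (k k1 k2 p p1 q : R -> R) : 0 < tau ->
  (forall x y, K x y = k (x - y)) ->
  (forall x : R, is_derive x 1 k (k1 x)) ->
  (forall x : R, is_derive x 1 k1 (k2 x)) -> continuous k2 ->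
  (forall x : R, is_derive x 1 p (p1 x)) -> continuous p1 -> continuous q ->
  p (- tau) = 0 -> p tau = 0 ->
  (forall x y, (p x - p y) * k2 (x - y) + (p1 x + p1 y) * k1 (x - y) +
               (q x - q y) * k (x - y) = 0) ->
  commutes_on tau K p q.
Proof.
move=> tau0 Kk dk dk1 ck2 dp cp1 cq pNtau ptau ode f [f1 [f2 [cf cf1 cf2 df df1]]].
have ck := is_derive_continuous _ _ _ dk.
have ck1 := is_derive_continuous _ _ _ dk1.
have cp := is_derive_continuous _ _ _ dp.
have tauN : - tau < tau by lra.
pose cw := @continuous_subspaceT R R `[- tau, tau].
have cc (r : R) : {within `[- tau, tau], continuous (cst r : R -> R)}.
  by apply: cw => ?; exact: cvg_cst.
have c1 := cc 1.
have cN : {within `[- tau, tau], continuous (fun y : R => - y)}.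
  by apply: cw; exact: opp_continuous.
(* [cst 1 y * x + - y] is [x - y] in affine form; derivatives in [x] fall on [h] alone, so [f] needs
   no extension beyond the segment. *)
pose F (w h : R -> R) (x : R) : R :=
  \int[lebesgue_measure]_(y in `[- tau, tau]) (w y * h (cst 1 y * x + - y)).
have dF (w h h1 : R -> R) (x : R) : {within `[- tau, tau], continuous w} ->
    (forall t : R, is_derive t 1 h (h1 t)) -> continuous h1 ->
    is_derive x 1 (F w h) (F w h1 x).
  move=> cw' dh ch1.
  have := is_derive_affine_integral _ _ _ _ c1 cN w h h1 x cw' dh ch1.
  congr is_derive.
  by apply: eq_Rintegral => y _; rewrite mulr1.
have KF : integral_op tau K f = F f k.
  apply/funext => x; apply: eq_Rintegral => y _.
  by rewrite Kk mul1r mulrC.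
have dF0 x := dF f k k1 x cf dk ck1.
have dF1 x := dF f k1 k2 x cf dk1 ck2.
have cF2 : continuous (F f k2) by exact: continuous_affine_integral.
have cF0 := is_derive_continuous _ _ _ dF0.
have cF1 := is_derive_continuous _ _ _ dF1.
split.
  exists (F f k1), (F f k2); rewrite KF.
  by split; [exact: cw|exact: cw|exact: cw|move=> x _|move=> x _].
move=> x xtau.
have iw (w h : R -> R) : {within `[- tau, tau], continuous w} -> continuous h ->
    lebesgue_measure.-integrable `[- tau, tau]
      (EFin \o (fun y => w y * h (cst 1 y * x + - y))).
  exact: affine_integrable.
have mtau : measurable (`[- tau, tau]%classic : set (measurableTypeR R)).
  exact: measurable_itv.
(* D f expanded by the product rule: continuous up to the endpoints, hence integrable. *)
pose w0 y := p1 y * f1 y + p y * f2 y + q y * f y.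
have cw0 : {within `[- tau, tau], continuous w0}.
  apply: within_continuousD; first apply: within_continuousD;
    apply: within_continuousM => //; exact: cw.
have -> : integral_op tau K (sturm_liouville p q f) x = F w0 k x.
  apply: eq_Rintegral_itvoo; last exact: iw.
  move=> y ytau; rewrite Kk mul1r mulrC; congr (_ * _).
  rewrite /sturm_liouville; congr (_ + _); rewrite derive1E.
  apply: derive_val.
  (* The derivative of [f] is known to be [f1] only in the open interval, which contains a
     neighbourhood of [y]. *)
  apply: (@near_eq_is_derive _ _ _ (p * f1)).
    near=> z; rewrite fctE; congr (_ * _).
    rewrite derive1E; apply/esym; apply: derive_val; apply: df.
    by near: z; exact: near_in_itvoo.
  have := df1 y ytau => df1y.
  by apply: is_derive_eq; rewrite /GRing.scale/=; ring.
have -> : sturm_liouville p q (integral_op tau K f) x =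
    p1 x * F f k1 x + p x * F f k2 x + q x * F f k x.
  rewrite /sturm_liouville KF; congr (_ + _); rewrite derive1E.
  have -> : (F f k)^`()%classic = F f k1.
    by apply/funext => z; rewrite derive1E; apply: derive_val.
  apply: derive_val.
  have -> : (fun t => p t * F f k1 t) = p * F f k1 by [].
  by apply: is_derive_eq; rewrite /GRing.scale/=; ring.
(* W' is the difference of the two integrands, and W vanishes with p. *)
pose W (y : R) : R :=
  - p y * (f y * k1 (cst 1 y * x + - y) + f1 y * k (cst 1 y * x + - y)).
apply/eqP; rewrite -subr_eq0; apply/eqP.
pose kx (h : R -> R) y := h (cst 1 y * x + - y).
have ckx (h : R -> R) : continuous h -> {within `[- tau, tau], continuous (kx h)}.
  move=> ch; apply: (within_continuous_comp _ _ h) => [t _|]; first exact: ch.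
  exact: within_continuousD (within_continuousM c1 (cc x)) cN.
(* The four summands are named so that their continuity gives the integrability needed to merge the
   integrals into one. *)
pose G1 y := p1 x * (f y * kx k1 y).
pose G2 y := p x * (f y * kx k2 y).
pose G3 y := q x * (f y * kx k y).
pose G4 y := w0 y * kx k y.
have cM g h := @within_continuousM R `[- tau, tau] g h.
have cD (g h : R -> R) :
    {within `[- tau, tau], continuous g} -> {within `[- tau, tau], continuous h} ->
    {within `[- tau, tau], continuous (fun y => g y + h y)}.
  exact: within_continuousD.
have cG1 : {within `[- tau, tau], continuous G1}.
  exact: cM _ _ (cc (p1 x)) (cM _ _ cf (ckx _ ck1)).
have cG2 : {within `[- tau, tau], continuous G2}.
  exact: cM _ _ (cc (p x)) (cM _ _ cf (ckx _ ck2)).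
have cG3 : {within `[- tau, tau], continuous G3}.
  exact: cM _ _ (cc (q x)) (cM _ _ cf (ckx _ ck)).
have cG4 : {within `[- tau, tau], continuous G4} by exact: cM _ _ cw0 (ckx _ ck).
have ic g :=
  @continuous_compact_integrable R g `[- tau, tau] (@segment_compact R _ _).
rewrite -(RintegralZl _ mtau (iw _ _ cf ck)) -(RintegralZl _ mtau (iw _ _ cf ck1)).
rewrite -(RintegralZl _ mtau (iw _ _ cf ck2)).
rewrite -(RintegralD mtau (ic _ cG1) (ic _ cG2)).
rewrite -(RintegralD mtau (ic _ (cD _ _ cG1 cG2)) (ic _ cG3)).
rewrite -(RintegralB mtau (ic _ (cD _ _ (cD _ _ cG1 cG2) cG3)) (ic _ cG4)).
have cB : {within `[- tau, tau], continuous (fun y => G1 y + G2 y + G3 y - G4 y)}.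
  exact: within_continuousB (cD _ _ (cD _ _ cG1 cG2) cG3) cG4.
rewrite (within_continuous_FTC2 _ _ _ _ W)//.
- by rewrite /W pNtau ptau oppr0 !mul0r subrr.
- have cNp : {within `[- tau, tau], continuous (fun y => - p y)}.
    by apply: cw => y; apply: cvgN; exact: cp.
  exact: cM _ _ cNp (cD _ _ (cM _ _ cf (ckx _ ck1)) (cM _ _ cf1 (ckx _ ck))).
- move=> y ytau.
  have dA : is_derive y 1 (cst x - id : R -> R) (- 1).
    by apply: is_derive_eq; rewrite sub0r.
  have dkx (h h1 : R -> R) : (forall t : R, is_derive t 1 h (h1 t)) ->
      is_derive y 1 (kx h) (- kx h1 y).
    move=> dh; rewrite /kx.
    have -> : (fun y => h (cst 1 y * x + - y)) = h \o (cst x - id).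
      by apply/funext => z; rewrite /= mul1r.
    have -> : - h1 (cst 1 y * x + - y) = h1 (x - y) * -1 by rewrite /= mul1r mulrN1.
    exact: (is_derive1_comp (f := h) (g := cst x - id) (dh (x - y)) dA).
  have dkx0 := dkx k k1 dk.
  have dkx1 := dkx k1 k2 dk1.
  have dfy := df y ytau.
  have df1y := df1 y ytau.
  have -> : W = - p * (f * kx k1 + f1 * kx k) by [].
  apply: is_derive_eq.
  have e : cst 1 y * x + - y = x - y by rewrite /= mul1r.
  rewrite /G1 /G2 /G3 /G4 /w0 /kx /GRing.scale/= !fctE e.
  (* The integrand minus the derivative of [W] is [f y] times the left side of [ode x y]. *)
  apply/eqP; rewrite eq_sym -subr_eq0 -[0](mulr0 (f y)) -(ode x y); apply/eqP.
  ring.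
Unshelve. all: by end_near. Qed.

(** Treats all cases at once: [beta] is [B ^+ 2] for [v] = sinh(Bt)/B and 0 for [v] = t, while
    [alpha] is [- A ^+ 2], [A ^+ 2] or 0 for [u] = sin(At)/A, sinh(At)/A or t. *)
Lemma commutes_on_ode (R : realType) (tau alpha beta : R) (kappa : R -> R)
    (u u1 v v1 : R -> R) : 0 < tau ->
  (forall x : R, is_derive x 1 u (u1 x)) ->
  (forall x : R, is_derive x 1 u1 (alpha * u x)) -> u 0 = 0 -> u1 0 = 1 ->
  (forall x : R, is_derive x 1 v (v1 x)) ->
  (forall x : R, is_derive x 1 v1 (beta * v x)) -> v1 0 = 1 ->
  (forall x, x != 0 -> v x != 0) -> (forall x, v (- x) = - v x) ->
  (forall x y, v x ^+ 2 - v y ^+ 2 = v (x + y) * v (x - y)) ->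
  (forall x y, v x * v1 x + v y * v1 y = v (x + y) * v1 (x - y)) ->
  (forall t, t != 0 -> kappa t = u t / v t) ->
  commutes_on tau (conv_kernel kappa)
    (fun x => v x ^+ 2 - v tau ^+ 2) (fun x => (beta - alpha) * v x ^+ 2).
Proof.
move=> tau0 du du1 u0 u10 dv dv1 v10 vneq0 vN vv vv1 kappaE.
have v0 : v 0 = 0 by have := vN 0; rewrite oppr0 => h; lra.
have dZ (c : R) (f f1 : R -> R) : (forall x : R, is_derive x 1 f (f1 x)) ->
    forall x : R, is_derive x 1 (fun y => c * f y) (c * f1 x).
  by move=> df x; exact: (is_deriveZ c (df x)).
have cZ (c : R) (f f1 : R -> R) : (forall x : R, is_derive x 1 f (f1 x)) ->
    continuous (fun y => c * f y).
  by move=> df; exact: is_derive_continuous (dZ c _ _ df).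
have [k [k1 [k2 [dk dk1 ck2 vk k0]]]] := quotient_C2 _ u u1 _ _ v v1 _ _
  du du1 (dZ alpha _ _ du) (cZ alpha _ _ du1) u0
  dv dv1 (dZ beta _ _ dv) (cZ beta _ _ dv1) v0
  (eq_ind_r (fun r => r != 0) (oner_neq0 R) v10) vneq0.
have ode t : v t * k2 t + 2 * v1 t * k1 t + (beta - alpha) * v t * k t = 0.
  (* The derivatives of [u] and [v * k] are compared without dividing by [v], so the point 0 is
     included. *)
  have e1 s : v s * k1 s + k s * v1 s = u1 s.
    have := derive_val (is_derive := du s).
    have -> : u = v * k by apply/funext => z; rewrite fctE vk.
    by rewrite derive_val.
  have : 'D_1 u1 t = alpha * u t by apply: derive_val.
  have -> : u1 = v * k1 + k * v1 by apply/funext => z; rewrite !fctE e1.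
  rewrite derive_val -vk /GRing.scale/= => e2.
  by rewrite -(subrr (alpha * (v t * k t))) -{1}e2; ring.
have dp (x : R) : is_derive x 1 (fun x => v x ^+ 2 - v tau ^+ 2) (2 * v x * v1 x).
  have -> : (fun x => v x ^+ 2 - v tau ^+ 2) = v * v - cst (v tau ^+ 2) by [].
  by apply: is_derive_eq; rewrite /GRing.scale/=; ring.
have cv := is_derive_continuous _ _ _ dv.
have cv1 := is_derive_continuous _ _ _ dv1.
apply: (commutes_on_convolution _ _ _ k k1 k2 _ (fun x => 2 * v x * v1 x)) => //.
(* On the diagonal, the value 1 of [conv_kernel] is [k 0 = u1 0 / v1 0]. *)
- move=> x y; rewrite /conv_kernel; have [->|xy] := eqVneq x y.
    by rewrite subrr k0 u10 v10 divr1.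
  have xy0 : x - y != 0 by rewrite subr_eq0.
  by rewrite kappaE// -vk mulrC mulKf// vneq0.
- move=> x; apply: cvgM; last exact: cv1.
  by apply: cvgM; [exact: cvg_cst|exact: cv].
- move=> x; apply: cvgM; first exact: cvg_cst.
  by apply: (@cvg_comp _ _ _ _ (fun z => z ^+ 2));
    [exact: cv|exact: exprn_continuous].
- by rewrite vN sqrrN subrr.
- by rewrite subrr.
(* The required identity is the equation for [k] at [x - y] multiplied by [v (x + y)]. *)
- move=> x y; rewrite -[RHS](mulr0 (v (x + y))) -(ode (x - y)).
  have -> : v x ^+ 2 - v tau ^+ 2 - (v y ^+ 2 - v tau ^+ 2) = v (x + y) * v (x - y).
    by rewrite -vv; ring.
  have -> : 2 * v x * v1 x + 2 * v y * v1 y = 2 * (v (x + y) * v1 (x - y)).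
    by rewrite -vv1; ring.
  by rewrite -mulrBr vv; ring.
Qed.

(** * Hyperbolic and trigonometric functions and their dilations *)

Definition cosh {R : realType} (x : R) : R := (expR x + expR (- x)) / 2.

Section sinh_cosh.
Context {R : realType}.
Implicit Types x y c : R.

Lemma is_derive_dilation (f : R -> R) (c x l : R) :
  is_derive (c * x) 1 f l -> is_derive x 1 (fun y => f (c * y)) (c * l).
Proof.
move=> df; have dA : is_derive x 1 (c \*: id : R -> R) c.
  by apply: is_derive_eq; exact: mulr1.
rewrite mulrC; exact: (is_derive1_comp (f := f) (g := c \*: id) df dA).
Qed.

Lemma is_derive_expRN x : is_derive x 1 (fun y => expR (- y)) (- expR (- x)).
Proof.
have -> : (fun y : R => expR (- y)) = (fun y => expR (-1 * y)).
  by apply/funext => y; rewrite mulN1r.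
rewrite -(mulN1r (expR _)) -(mulN1r x); exact: is_derive_dilation.
Qed.

Lemma is_derive_sinh x : is_derive x 1 (@sinh R) (cosh x).
Proof.
have -> : @sinh R = 2^-1 \*: (expR - (fun y => expR (- y))).
  by apply/funext => y; rewrite /sinh mulrC.
have := is_derive_expRN x => dN.
by apply: is_derive_eq; rewrite /cosh /GRing.scale/= opprK mulrC.
Qed.

Lemma is_derive_cosh x : is_derive x 1 (@cosh R) (sinh x).
Proof.
have -> : @cosh R = 2^-1 \*: (expR + (fun y => expR (- y))).
  by apply/funext => y; rewrite /cosh mulrC.
have := is_derive_expRN x => dN.
by apply: is_derive_eq; rewrite /sinh /GRing.scale/= mulrC.
Qed.

Lemma sinh0 : sinh 0 = 0 :> R.
Proof. by rewrite /sinh oppr0 subrr mul0r. Qed.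

Lemma cosh0 : cosh 0 = 1 :> R.
Proof. by rewrite /cosh oppr0 expR0 -(natrD _ 1 1) divff. Qed.

Lemma sinhN x : sinh (- x) = - sinh x.
Proof. by rewrite /sinh opprK; lra. Qed.

Lemma sinh_neq0 x : x != 0 -> sinh x != 0.
Proof.
move=> x0; rewrite /sinh mulf_neq0// ?invr_neq0// subr_eq0.
by apply: contra_neq x0 => /expR_inj ?; lra.
Qed.

(** In terms of [expR x] and [expR y], which are nonzero, this is a rational identity. *)
Lemma sinh_sqrB x y : sinh x ^+ 2 - sinh y ^+ 2 = sinh (x + y) * sinh (x - y).
Proof.
rewrite /sinh !opprD opprK !expRD !expRN.
by field; rewrite !gt_eqF ?expR_gt0.
Qed.

Lemma sinh_coshD x y :
  sinh x * cosh x + sinh y * cosh y = sinh (x + y) * cosh (x - y).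
Proof.
rewrite /sinh /cosh !opprD opprK !expRD !expRN.
by field; rewrite !gt_eqF ?expR_gt0.
Qed.

(** Dividing by [c] normalises the slope at 0 to 1, as [commutes_on_ode] requires of [u] and [v]. *)
Lemma is_derive_sinh_dilation c x : c != 0 ->
  is_derive x 1 (fun y => sinh (c * y) / c) (cosh (c * x)).
Proof.
move=> c0; have dS := is_derive_dilation _ _ _ _ (is_derive_sinh (c * x)).
have -> : (fun y => sinh (c * y) / c) = c^-1 \*: (fun y => sinh (c * y)).
  by apply/funext => y; rewrite mulrC.
by apply: is_derive_eq; rewrite /GRing.scale/= mulKf.
Qed.

Lemma is_derive_cosh_dilation c x : c != 0 ->
  is_derive x 1 (fun y => cosh (c * y)) (c ^+ 2 * (sinh (c * x) / c)).
Proof.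
move=> c0; have dC := is_derive_dilation _ _ _ _ (is_derive_cosh (c * x)).
by apply: is_derive_eq; field.
Qed.

Lemma is_derive_sin_dilation c x : c != 0 ->
  is_derive x 1 (fun y => sin (c * y) / c) (cos (c * x)).
Proof.
move=> c0; have dS := is_derive_dilation _ _ _ _ (is_derive_sin (c * x)).
have -> : (fun y => sin (c * y) / c) = c^-1 \*: (fun y => sin (c * y)).
  by apply/funext => y; rewrite mulrC.
by apply: is_derive_eq; rewrite /GRing.scale/= mulKf.
Qed.

Lemma is_derive_cos_dilation c x : c != 0 ->
  is_derive x 1 (fun y => cos (c * y)) (- c ^+ 2 * (sin (c * x) / c)).
Proof.
move=> c0; have dC := is_derive_dilation _ _ _ _ (is_derive_cos (c * x)).
by apply: is_derive_eq; field.
Qed.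

End sinh_cosh.

(** * The concrete kernels and their limit cases *)

Lemma commutes_on_sinh (R : realType) (tau alpha B : R) (kappa u u1 : R -> R) :
  0 < tau -> B != 0 ->
  (forall x : R, is_derive x 1 u (u1 x)) ->
  (forall x : R, is_derive x 1 u1 (alpha * u x)) -> u 0 = 0 -> u1 0 = 1 ->
  (forall t, t != 0 -> kappa t = u t * B / sinh (B * t)) ->
  commutes_on tau (conv_kernel kappa)
    (fun x => (sinh (B * x) ^+ 2 - sinh (B * tau) ^+ 2) / B ^+ 2)
    (fun x => (B ^+ 2 - alpha) * sinh (B * x) ^+ 2 / B ^+ 2).
Proof.
move=> tau0 B0 du du1 u0 u10 kappaE.
have -> : (fun x => (sinh (B * x) ^+ 2 - sinh (B * tau) ^+ 2) / B ^+ 2) =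
    (fun x => (sinh (B * x) / B) ^+ 2 - (sinh (B * tau) / B) ^+ 2).
  by apply/funext => x; field.
have -> : (fun x => (B ^+ 2 - alpha) * sinh (B * x) ^+ 2 / B ^+ 2) =
    (fun x => (B ^+ 2 - alpha) * (sinh (B * x) / B) ^+ 2).
  by apply/funext => x; field.
apply: (commutes_on_ode _ _ alpha (B ^+ 2) _ u u1 (fun x => sinh (B * x) / B)
  (fun x => cosh (B * x))) => //.
- by move=> x; exact: is_derive_sinh_dilation.
- by move=> x; exact: is_derive_cosh_dilation.
- by rewrite mulr0 cosh0.
- by move=> x x0; rewrite mulf_neq0 ?invr_neq0// sinh_neq0// mulf_neq0.
- by move=> x; rewrite mulrN sinhN mulNr.
- move=> x y; rewrite mulrDr mulrBr.
  transitivity ((sinh (B * x) ^+ 2 - sinh (B * y) ^+ 2) / B ^+ 2); first by field.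
  by rewrite sinh_sqrB; field.
- move=> x y; rewrite mulrDr mulrBr.
  transitivity ((sinh (B * x) * cosh (B * x) + sinh (B * y) * cosh (B * y)) / B).
    by field.
  by rewrite sinh_coshD; field.
- by move=> t t0; rewrite kappaE// [in RHS]invfM invrK; ring.
Qed.

Lemma commutes_on_id (R : realType) (tau alpha : R) (kappa u u1 : R -> R) :
  0 < tau ->
  (forall x : R, is_derive x 1 u (u1 x)) ->
  (forall x : R, is_derive x 1 u1 (alpha * u x)) -> u 0 = 0 -> u1 0 = 1 ->
  (forall t, t != 0 -> kappa t = u t / t) ->
  commutes_on tau (conv_kernel kappa)
    (fun x => x ^+ 2 - tau ^+ 2) (fun x => - alpha * x ^+ 2).
Proof.
(* Puts the coefficient in the form [beta - alpha] with [beta = 0]. *)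
move=> tau0 du du1 u0 u10 kappaE; rewrite -[- alpha]sub0r.
apply: (commutes_on_ode _ _ alpha 0 _ u u1 id (cst 1)) => // x.
- by rewrite mul0r; exact: is_derive_cst.
- by move=> y; ring.
- by move=> y /=; ring.
Qed.

Theorem proposition6p1 (R : realType) (tau : R) (htau : 0 < tau) :
  [/\ (* sin/sinh kernel *)
      forall A B : R, 0 < B -> A != 0 ->
        commutes_on tau (sin_sinh_kernel A B)
          (fun x => (sinh (B * x) ^+ 2 - sinh (B * tau) ^+ 2) / B ^+ 2)
          (fun x => (B ^+ 2 + A ^+ 2) * sinh (B * x) ^+ 2 / B ^+ 2),
      (* sinh/sinh kernel *)
      forall A B : R, 0 < B -> A != 0 ->
        commutes_on tau (sinh_sinh_kernel A B)
          (fun x => (sinh (B * x) ^+ 2 - sinh (B * tau) ^+ 2) / B ^+ 2)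
          (fun x => (B ^+ 2 - A ^+ 2) * sinh (B * x) ^+ 2 / B ^+ 2),
      (* limit case A = 0 of both kernels *)
      forall B : R, 0 < B ->
        commutes_on tau (id_sinh_kernel B)
          (fun x => (sinh (B * x) ^+ 2 - sinh (B * tau) ^+ 2) / B ^+ 2)
          (fun x => sinh (B * x) ^+ 2),
      (* limit case B = 0 of the sin/sinh kernel *)
      forall A : R, A != 0 ->
        commutes_on tau (sin_id_kernel A)
          (fun x => x ^+ 2 - tau ^+ 2)
          (fun x => A ^+ 2 * x ^+ 2)
    & (* limit case B = 0 of the sinh/sinh kernel *)
      forall A : R, A != 0 ->
        commutes_on tau (sinh_id_kernel A)
          (fun x => x ^+ 2 - tau ^+ 2)
          (fun x => - A ^+ 2 * x ^+ 2)].
Proof.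
split.
- move=> A B B0 A0; have {}B0 : B != 0 by rewrite gt_eqF.
  (* The plus sign comes from [alpha = - A ^+ 2], the sine solving u'' = - A^2 u. *)
  rewrite -[A ^+ 2]opprK.
  apply: (commutes_on_sinh _ _ _ _ _ (fun x => sin (A * x) / A)
    (fun x => cos (A * x))) => //.
  + by move=> x; exact: is_derive_sin_dilation.
  + by move=> x; exact: is_derive_cos_dilation.
  + by rewrite mulr0 sin0 mul0r.
  + by rewrite mulr0 cos0.
  + by move=> t t0; rewrite invfM; ring.
- move=> A B B0 A0; have {}B0 : B != 0 by rewrite gt_eqF.
  apply: (commutes_on_sinh _ _ _ _ _ (fun x => sinh (A * x) / A)
    (fun x => cosh (A * x))) => //.
  + by move=> x; exact: is_derive_sinh_dilation.
  + by move=> x; exact: is_derive_cosh_dilation.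
  + by rewrite mulr0 sinh0 mul0r.
  + by rewrite mulr0 cosh0.
  + by move=> t t0; rewrite invfM; ring.
- move=> B B0; have {}B0 : B != 0 by rewrite gt_eqF.
  (* Here [u] is the identity, so [alpha = 0]. *)
  have -> : (fun x => sinh (B * x) ^+ 2) =
      (fun x => (B ^+ 2 - 0) * sinh (B * x) ^+ 2 / B ^+ 2).
    by apply/funext => x; field.
  apply: (commutes_on_sinh _ _ _ _ _ id (cst 1)) => //.
  + by move=> x; rewrite mul0r; exact: is_derive_cst.
  + by move=> t t0; rewrite [B * t]mulrC.
- move=> A A0; rewrite -[A ^+ 2]opprK.
  apply: (commutes_on_id _ _ _ _ (fun x => sin (A * x) / A)
    (fun x => cos (A * x))) => //.
  + by move=> x; exact: is_derive_sin_dilation.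
  + by move=> x; exact: is_derive_cos_dilation.
  + by rewrite mulr0 sin0 mul0r.
  + by rewrite mulr0 cos0.
  + by move=> t t0; rewrite invfM mulrA.
- move=> A A0.
  apply: (commutes_on_id _ _ _ _ (fun x => sinh (A * x) / A)
    (fun x => cosh (A * x))) => //.
  + by move=> x; exact: is_derive_sinh_dilation.
  + by move=> x; exact: is_derive_cosh_dilation.
  + by rewrite mulr0 sinh0 mul0r.
  + by rewrite mulr0 cosh0.
  + by move=> t t0; rewrite invfM mulrA.
Qed.
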